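(* Let $a>1$, $(x,u,\eta)\in\mathbb{R}^3$ and $\omega_j:=1-\frac{2j}{n}$. For $k,m\ge0$, let $S_n^{h_m,x}(t,a)=h_m(t-x)F_n(t,a)$. Then $$V_{h_k}(S_n^{h_m,x})(u,\eta)=\sqrt\pi\,(-1)^m2^{\frac{k+m}{2}}e^{-\frac{i(x+u)\eta}{2}-\frac{(x-u)^2}{4}}\sum_{j=0}^nC_j(n,a)\,e^{-\frac{(\omega_j-\eta)^2}{4}+\frac{i(u+x)\omega_j}{2}}H_{k,m}(\alpha_j,\overline{\alpha_j}),$$ with $\alpha_j:=\frac{(u-x)+i(\omega_j-\eta)}{\sqrt2}$.
   Context: Hermite functions: $h_m(t)=e^{-t^2/2}H_m(t)=(-1)^me^{t^2/2}\frac{d^m}{dt^m}(e^{-t^2})$. The 2D-complex Hermite polynomials are $H_{k,\ell}(z,w)=\sum_{j=0}^{\min(k,\ell)}(-1)^jj!\binom kj\binom\ell jz^{\ell-j}w^{k-j}$, $(z,w)\in\mathbb{C}^2$. The short-time Fourier transform of $f\in L^2(\mathbb{R})$ with window $g\in L^2(\mathbb{R})$ is $V_g(f)(x,\omega)=\int_{\mathbb{R}}e^{-it\omega}\overline{g(t-x)}f(t)\,dt$. The superoscillating sequence, $n\in\mathbb{N}$, is $F_n(t,a)=\sum_{j=0}^nC_j(n,a)e^{i(1-2j/n)t}$ with $C_j(n,a)=\binom{n}{j}\left(\frac{1+a}{2}\right)^{n-j}\left(\frac{1-a}{2}\right)^j$.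
   Formalization: The prefactor (-1)^m is replaced by (-1)^k: the printed sign is wrong when k+m is odd (e.g. n=1, x=u=η=0, k=1, m=0 gives i·a·√π·e^{-1/4} on the left and its negative on the right); n≥1 is assumed so that ω_j is defined. *)

(* Defs.v *)
From HB Require Import structures.
From mathcomp Require Import all_boot all_order all_algebra.
From mathcomp Require Import complex.
From mathcomp Require Import all_classical all_reals all_analysis.
Set Implicit Arguments.
Unset Strict Implicit.
Unset Printing Implicit Defensive.
Import Order.TTheory GRing.Theory Num.Theory.
Import numFieldNormedType.Exports.
Local Open Scope ring_scope.
Local Open Scope complex_scope.

Definition cexp (R : realType) (z : R[i]) : R[i] :=
  (expR (complex.Re z) * cos (complex.Im z))
  +i* (expR (complex.Re z) * sin (complex.Im z)).

(* Lebesgue integral over the real line, taken componentwise; a component that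
   is not integrable gets a junk value, as with [Rintegral]. *)
Definition cintegral (R : realType) (F : R -> R[i]) : R[i] :=
  Rintegral (@lebesgue_measure R) setT (fun t => complex.Re (F t))
  +i* Rintegral (@lebesgue_measure R) setT (fun t => complex.Im (F t)).

(* h_m(t) = e^{-t^2/2} H_m(t), H_m being the physicists' Hermite polynomial,
   given by its Rodrigues formula; [derive1n] is the m-th derivative. *)
Definition hermite_fun (R : realType) (m : nat) (t : R) : R :=
  (-1) ^+ m * expR (t ^+ 2 / 2) * derive1n m (fun s : R => expR (- s ^+ 2)) t.

(* The convention is z^{l-j} w^{k-j}: the first index goes with the second
   variable. The subtractions do not truncate, since j <= min(k, l). *)
Definition chermite2 (R : realType) (k l : nat) (z w : R[i]) : R[i] :=
  \sum_(0 <= j < (minn k l).+1)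
    (-1) ^+ j * (j`!)%:R * ('C(k, j))%:R * ('C(l, j))%:R
      * z ^+ (l - j) * w ^+ (k - j).

Definition STFT (R : realType) (g f : R -> R[i]) (x w : R) : R[i] :=
  cintegral (fun t => cexp (- ('i%C * (t * w)%:C)) * ((g (t - x))^*)%C * f t).

Definition so_freq (R : realType) (n j : nat) : R := 1 - 2 * j%:R / n%:R.

Definition so_coef (R : realType) (j n : nat) (a : R) : R :=
  ('C(n, j))%:R * ((1 + a) / 2) ^+ (n - j) * ((1 - a) / 2) ^+ j.

Definition so_seq (R : realType) (n : nat) (t a : R) : R[i] :=
  \sum_(0 <= j < n.+1) (so_coef j n a)%:C * cexp ('i%C * (so_freq R n j * t)%:C).

Definition so_signal (R : realType) (n m : nat) (x a t : R) : R[i] :=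
  (hermite_fun m (t - x))%:C * so_seq n t a.

Definition so_alpha (R : realType) (n j : nat) (x u eta : R) : R[i] :=
  ((u - x)%:C + 'i%C * (so_freq R n j - eta)%:C) / (Num.sqrt 2)%:C.

(* Main.v *)
Require Import Defs.
From HB Require Import structures.
From mathcomp Require Import all_boot all_order all_algebra.
From mathcomp Require Import complex ring lra.
From mathcomp Require Import all_classical all_reals all_analysis measurable_realfun.
Set Implicit Arguments.
Unset Strict Implicit.
Unset Printing Implicit Defensive.
Import Order.TTheory GRing.Theory Num.Theory.
Import numFieldNormedType.Exports.
Local Open Scope ring_scope.
Local Open Scope complex_scope.

(** The superoscillating signal is a finite combination of modulated Hermite
functions, so by linearity it suffices to transform one of them.  Write
[h_k(t) = He_k(t) e^{-t^2/2}] with [He_k] a polynomial ([hermite_funE]) and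
complete the square:
  [e^{-(t-u)^2/2} e^{-(t-x)^2/2} = e^{-(x-u)^2/4} e^{-(t-c)^2}],
with [c = (u+x)/2].  With [s = omega_j - eta], everything reduces to
  [I(k,m) = int He_k(t-u) He_m(t-x) e^{-(t-c)^2} e^{ist} dt],
a value of the linear functional [P |-> int P(t) e^{-(t-c)^2} e^{ist} dt] on
real polynomials, called [gaussF c s] below.

That functional is governed by one identity, integration by parts
([gaussF_parts]): the integral of the derivative of [P(t) e^{-(t-c)^2} e^{ist}]
over the line vanishes.  Two consequences carry the proof.

- For [P = 1] it expresses the first moment, which is [-i] times the derivative
  in [s] of [gaussF c s 1], through [gaussF c s 1] itself.  This linear differential
  equation has the solution
  [gaussF c s 1 = sqrt pi e^{-s^2/4} e^{ics}] ([gaussF_1]), the constant being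
  the Gaussian integral.

- For [P(t) = He_k(t-u) He_m(t-x)], the relations
  [He_{k+1} = 2t He_k - He_k'] and [He_m' = 2m He_{m-1}] turn it into
  [I(k+1,m) = ((x-u) + is) I(k,m) + 2m I(k,m-1)] ([gaussF_rec0] and
  [gaussF_recS]).

The complex Hermite polynomials satisfy
[H_{k+1,m} = w H_{k,m} - m H_{k,m-1}] by Pascal's rule ([chermite2S0] and
[chermite2SS]).  At [z = alpha], [w] its conjugate, the coefficient
[(x-u) + is] is [- sqrt 2 w], so the two recurrences agree once the second is
scaled by [(-1)^k 2^{(k+m)/2}]; induction gives [gaussF_hermite2].  The rest of
the proof collects the exponential factors. *)

(** * Polynomials times a Gaussian *)

Definition gauss (R : realType) (c t : R) : R := expR (- (t - c) ^+ 2).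

(** The exponent is kept arbitrary so that the induction on [P] can split it in
two: one half absorbs the factor [t], the other half the remaining polynomial. *)
Lemma horner_expR_bound (R : realType) (c : R) (P : {poly R}) (e : R) : 0 < e ->
  exists2 C, 0 <= C & forall t, `|P.[t]| <= C * expR (e * (t - c) ^+ 2).
Proof.
elim/poly_ind: P e => [|P a IH] e e0.
  by exists 0 => // t; rewrite horner0 normr0 mul0r.
have [C C0 HC] := IH (e / 2) ltac:(lra).
have ge1 t : 1 <= expR (e * (t - c) ^+ 2).
  by rewrite -expR0 ler_expR mulr_ge0// ?sqr_ge0// ltW.
have lin t : `|t| <= (`|c| + 1 + 2 / e) * expR (e / 2 * (t - c) ^+ 2).
  have := expR_ge1Dx (e / 2 * (t - c) ^+ 2).
  set E := expR _ => hE.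
  have h2 : (t - c) ^+ 2 <= 2 / e * E.
    rewrite -(ler_pM2l (x := e / 2)); last lra.
    rewrite (_ : e / 2 * (2 / e * E) = E); first lra.
    by field; rewrite gt_eqF.
  have h1 : 1 <= E.
    by apply: le_trans hE; rewrite lerDl mulr_ge0 ?sqr_ge0//; lra.
  have h3 : `|t - c| <= 1 + (t - c) ^+ 2.
    by rewrite -real_normK ?num_real//; nra.
  have h4 : `|t| <= `|c| + `|t - c|.
    by rewrite (le_trans _ (ler_normD _ _))// addrC subrK.
  have h5 : 0 <= `|c| by [].
  have : `|c| * 1 <= `|c| * E by exact: ler_wpM2l.
  nra.
exists (C * (`|c| + 1 + 2 / e) + `|a|).
  rewrite addr_ge0// mulr_ge0// addr_ge0 ?addr_ge0 ?divr_ge0//; lra.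
move=> t; rewrite hornerMXaddC (le_trans (ler_normD _ _))// normrM mulrDl.
apply: lerD; last by rewrite ler_peMr.
have -> : e * (t - c) ^+ 2 = e / 2 * (t - c) ^+ 2 + e / 2 * (t - c) ^+ 2 by field.
by rewrite expRD mulrACA ler_pM.
Qed.

Lemma continuous_gauss (R : realType) (c : R) : continuous (gauss c).
Proof.
move=> t; apply: continuous_comp; last exact: continuous_expR.
apply: cvgN; apply: (@continuous_comp _ _ _ (fun t => t - c) (fun y => y ^+ 2)).
  by apply: cvgB; [exact: cvg_id|exact: cvg_cst].
exact: exprn_continuous.
Qed.

(** This is the total mass of the normal law of mean [c] and variance 1/2. *)
Lemma Rintegral_gauss (R : realType) (c : R) :
  Rintegral lebesgue_measure setT (gauss c) = Num.sqrt pi.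
Proof.
pose s : R := Num.sqrt (1 / 2).
have s2 : s ^+ 2 = 1 / 2 by rewrite sqr_sqrtr//; lra.
have s0 : s != 0 by rewrite gt_eqF// sqrtr_gt0; lra.
have pks : normal_peak s = (Num.sqrt pi)^-1.
  by rewrite /normal_peak s2; congr (Num.sqrt _)^-1; field.
have p0 : Num.sqrt (pi : R) != 0 by rewrite gt_eqF// sqrtr_gt0 pi_gt0.
have gE : gauss c = (fun t => Num.sqrt pi * normal_pdf c s t).
  apply/funext => t; rewrite normal_pdfE// pks mulrA divff// mul1r.
  by rewrite /normal_fun s2 /gauss; congr expR; field.
rewrite gE RintegralZl//; last exact: integrable_normal_pdf.
by rewrite /Rintegral integral_normal_pdf /= mulr1.
Qed.

Lemma integrable_half_gauss (R : realType) (c : R) :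
  lebesgue_measure.-integrable [set: R] (fun t => (expR (- ((t - c) ^+ 2 / 2)))%:E).
Proof.
have iN := integrable_normal_pdf c (1 : R).
have := integrableZl (measurableT) ((normal_peak (1:R))^-1) iN.
apply: eq_integrable => // t _ /=.
rewrite -EFinM normal_pdfE ?oner_eq0// mulrA mulVf ?gt_eqF ?normal_peak_gt0 ?oner_eq0//.
by rewrite mul1r /normal_fun expr1n mulNr.
Qed.

(** Half of the Gaussian decay is spent on the polynomial; the other half is
still integrable. *)
Lemma horner_gauss_bound (R : realType) (c : R) (P : {poly R}) :
  exists2 C, 0 <= C &
    forall t, `|P.[t] * gauss c t| <= C * expR (- ((t - c) ^+ 2 / 2)).
Proof.
have [C C0 HC] := horner_expR_bound c P (ltac:(lra) : 0 < 1 / 2 :> R).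
exists C => // t; rewrite normrM (ger0_norm (expR_ge0 _)).
rewrite (_ : - ((t - c) ^+ 2 / 2) = 1 / 2 * (t - c) ^+ 2 + - (t - c) ^+ 2); last by field.
by rewrite expRD mulrA ler_wpM2r// expR_ge0.
Qed.

Lemma continuous_hornerG (R : realType) (c : R) (P : {poly R}) :
  continuous (fun t => P.[t] * gauss c t).
Proof. by move=> t; apply: cvgM; [exact: continuous_horner|exact: continuous_gauss]. Qed.

Lemma integrable_horner_gaussM (R : realType) (c : R) (P : {poly R}) (T : R -> R) M :
  continuous T -> (forall t, `|T t| <= M) ->
  lebesgue_measure.-integrable [set: R] (EFin \o (fun t => P.[t] * gauss c t * T t)).
Proof.
move=> cT TM; have [C C0 HC] := horner_gauss_bound c P.
have iE := integrableZl measurableT (C * M) (integrable_half_gauss c).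
apply: le_integrable iE => //.
  apply/measurable_EFinP; apply: continuous_measurable_fun => t.
  by apply: cvgM; [exact: continuous_hornerG|exact: cT].
move=> t _ /=; rewrite lee_fin normrM [leRHS]normrM.
have M0 : 0 <= M by exact: le_trans (TM 0).
rewrite (ger0_norm (mulr_ge0 C0 M0)) (ger0_norm (expR_ge0 _)) mulrAC.
by apply: ler_pM.
Qed.

(** * Integration by parts on the line *)

Section IntegralOfDerivative.
Local Open Scope classical_set_scope.

(** By the fundamental theorem of calculus the integral over [[-n, n]] is
[F n - F (- n)], which is [O(1/n)] by the decay hypothesis, while dominated
convergence sends it to the integral over the line. *)
Lemma Rintegral_deriv_eq0 (R : realType) (F f : R -> R) (K : R) :
  continuous f -> lebesgue_measure.-integrable [set: R] (EFin \o f) ->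
  (forall t : R, is_derive t (1 : R) F (f t)) ->
  (forall t, `|t| * `|F t| <= K) ->
  Rintegral lebesgue_measure setT f = 0.
Proof.
move=> cf intf dF decay.
pose I (n : nat) : set R := `[- n.+1%:R, n.+1%:R].
have FTC n : (\int[lebesgue_measure]_(t in I n) (f t)%:E =
    (F n.+1%:R - F (- n.+1%:R))%:E)%E.
  have cF : continuous F.
    by move=> t; apply: differentiable_continuous; apply/derivable1_diffP; exact: ex_derive.
  rewrite (@continuous_FTC2 _ f F) //.
  - by rewrite -subr_gt0 opprK addr_gt0.
  - exact: continuous_subspaceT.
  - split; first by move=> t _; exact: ex_derive.
    + by apply: cvg_at_right_filter; exact: cF.
    + by apply: cvg_at_left_filter; exact: cF.
  - by move=> t _; rewrite derive1E derive_val.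
have lim1 : (\int[lebesgue_measure]_(t in I n) (f t)%:E)%E @[n --> \oo] --> 0%:E.
  under eq_fun do rewrite FTC.
  apply: cvg_EFin; first exact: nearW.
  apply/cvgr0Pnorm_le => e e0.
  near=> n.
  have hn : K * 2 <= e * n.+1%:R.
    rewrite [leRHS]mulrC -ler_pdivrMr// -(natr1 n) -lerBlDr.
    near: n; exact: nbhs_infty_ger.
  rewrite /= (le_trans (ler_normB _ _))//.
  have := decay n.+1%:R; have := decay (- n.+1%:R); rewrite normrN normr_nat.
  have : 0 < n.+1%:R :> R by [].
  nra.
have lim2 : (\int[lebesgue_measure]_(t in I n) (f t)%:E)%E @[n --> \oo] -->
    (\int[lebesgue_measure]_t (f t)%:E)%E.
  under eq_fun do rewrite integral_mkcond.
  apply: (@dominated_cvg _ _ R lebesgue_measure setT measurableT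
    (fun n => (fun t => (f t)%:E) \_ (I n)) (fun t => (f t)%:E)
    (fun t => `|(f t)%:E|)%E) => //.
  - move=> n; apply/measurable_restrict => //; first exact: measurable_itv.
    by rewrite setTI; apply/measurable_EFinP/measurable_funTS; exact: continuous_measurable_fun.
  - move=> t _; apply: cvg_near_cst; near=> n.
    rewrite patchE mem_set// /I /= in_itv /= -ler_norml -(natr1 n) -lerBlDr.
    near: n; exact: nbhs_infty_ger.
  - exact: integrable_abse.
  - by move=> n t _; rewrite patchE; case: ifP => // _; rewrite abse0.
by rewrite /Rintegral -(cvg_unique _ lim1 lim2).
Unshelve. all: by end_near. Qed.

End IntegralOfDerivative.

Lemma is_derive_gauss (R : realType) (c t : R) :
  is_derive t (1 : R) (gauss c) (- (2 * (t - c) * gauss c t)).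
Proof.
apply: (is_derive_eq (f' := expR (- (t - c) ^+ 2) * - (2 * (t - c)))); last first.
  by rewrite /gauss; ring.
apply: is_derive1_comp; apply: is_derive_eq.
by rewrite /GRing.scale /=; ring.
Qed.

(** The left-hand side is the integral of the derivative of
[P(t) e^{-(t-c)^2} T(t)].  The oscillating factor [T] is a bounded function
with a bounded derivative, so that cosine and sine are treated at once. *)
Lemma integral_gauss_parts (R : realType) (c M N : R) (P : {poly R}) (T U : R -> R) :
  (forall t : R, is_derive t (1 : R) T (U t)) -> continuous U ->
  (forall t, `|T t| <= M) -> (forall t, `|U t| <= N) ->
  Rintegral lebesgue_measure setT
    (fun t => (P^`() - 2%:P * ('X - c%:P) * P).[t] * gauss c t * T t)
  + Rintegral lebesgue_measure setT (fun t => P.[t] * gauss c t * U t) = 0.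
Proof.
move=> dT cU TM UN.
have cT : continuous T.
  by move=> t; apply: differentiable_continuous; apply/derivable1_diffP; exact: ex_derive.
have M0 : 0 <= M by exact: le_trans (TM 0).
set Q := P^`() - _.
have iT := integrable_horner_gaussM c Q cT TM.
have iU := integrable_horner_gaussM c P cU UN.
rewrite -RintegralD//.
(* The extra factor ['X] provides the decay in [1/|t|] of the primitive. *)
have [C C0 HC] := horner_gauss_bound c (P * 'X).
apply: (@Rintegral_deriv_eq0 _ (fun t => P.[t] * gauss c t * T t) _ (C * M)).
- move=> t; apply: cvgD; apply: cvgM; try exact: continuous_hornerG.
  + exact: cT.
  + exact: cU.
- by have := integrableD measurableT iT iU; apply: eq_integrable.
- move=> t; have := is_derive_gauss c t => dg.
  apply: is_derive_eq.
  by rewrite /Q /GRing.scale /= !hornerE; ring.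
- move=> t; rewrite normrM mulrA; apply: ler_pM => //.
  have := HC t; rewrite hornerMX mulrAC normrM mulrC => /le_trans; apply.
  by rewrite ler_piMr// -expR0 ler_expR oppr_le0 divr_ge0// sqr_ge0.
Qed.

(** * Gaussian integrals against cosine and sine *)

Definition gaussI (R : realType) (c : R) (T : R -> R) (P : {poly R}) : R :=
  Rintegral lebesgue_measure setT (fun t => P.[t] * gauss c t * T t).

Section GaussI.
Variables (R : realType) (c M : R) (T : R -> R).
Hypotheses (cT : continuous T) (TM : forall t, `|T t| <= M).

Lemma gaussID P Q : gaussI c T (P + Q) = gaussI c T P + gaussI c T Q.
Proof.
rewrite /gaussI -RintegralD//; [|exact: (integrable_horner_gaussM _ _ cT TM)..].
by apply: eq_Rintegral => t _; rewrite hornerD; ring.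
Qed.

Lemma gaussIM a P : gaussI c T (a%:P * P) = a * gaussI c T P.
Proof.
rewrite /gaussI -RintegralZl//; last exact: (integrable_horner_gaussM _ _ cT TM).
by apply: eq_Rintegral => t _; rewrite hornerM hornerC; ring.
Qed.

End GaussI.

Definition cosf (R : realType) (s t : R) : R := cos (s * t).
Definition sinf (R : realType) (s t : R) : R := sin (s * t).

Lemma is_derive_cosf (R : realType) (s t : R) :
  is_derive t (1 : R) (cosf s) (- s * sinf s t).
Proof.
apply: (is_derive_eq (f' := - sin (s * t) * s)); last by rewrite /sinf; ring.
apply: (is_derive1_comp (f := cos) (g := fun t => s * t)).
by apply: is_derive_eq; rewrite /GRing.scale /=; ring.
Qed.

Lemma is_derive_sinf (R : realType) (s t : R) :
  is_derive t (1 : R) (sinf s) (s * cosf s t).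
Proof.
apply: (is_derive_eq (f' := cos (s * t) * s)); last by rewrite /cosf; ring.
apply: (is_derive1_comp (f := sin) (g := fun t => s * t)).
by apply: is_derive_eq; rewrite /GRing.scale /=; ring.
Qed.

Lemma continuous_cosf (R : realType) (s : R) : continuous (cosf s).
Proof.
by move=> t; apply: differentiable_continuous; apply/derivable1_diffP;
   have := is_derive_cosf s t => d; exact: ex_derive.
Qed.

Lemma continuous_sinf (R : realType) (s : R) : continuous (sinf s).
Proof.
by move=> t; apply: differentiable_continuous; apply/derivable1_diffP;
   have := is_derive_sinf s t => d; exact: ex_derive.
Qed.

Lemma norm_cosf (R : realType) (s t : R) : `|cosf s t| <= 1.
Proof. by rewrite ler_norml cos_geN1 cos_le1. Qed.

Lemma norm_sinf (R : realType) (s t : R) : `|sinf s t| <= 1.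
Proof. by rewrite ler_norml sin_geN1 sin_le1. Qed.

Lemma gaussI_cos_parts (R : realType) (c s : R) (P : {poly R}) :
  gaussI c (cosf s) (P^`() - 2%:P * ('X - c%:P) * P) = s * gaussI c (sinf s) P.
Proof.
have := @integral_gauss_parts _ c 1 `|s| P _ _ (is_derive_cosf s).
move=> /(_ _ (norm_cosf s)) H; apply/eqP; rewrite -subr_eq0 -(mulN1r (s * _)) mulrA mulN1r.
rewrite -RintegralZl//; last first.
  exact: (integrable_horner_gaussM _ _ (@continuous_sinf _ s) (norm_sinf s)).
apply/eqP; rewrite -[RHS]H.
- by congr (_ + _); apply: eq_Rintegral => t _; ring.
- by move=> t; apply: cvgM; [exact: cvg_cst|exact: continuous_sinf].
- by move=> t; rewrite normrM normrN ler_piMr// norm_sinf.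
Qed.

Lemma gaussI_sin_parts (R : realType) (c s : R) (P : {poly R}) :
  gaussI c (sinf s) (P^`() - 2%:P * ('X - c%:P) * P) = - s * gaussI c (cosf s) P.
Proof.
have := @integral_gauss_parts _ c 1 `|s| P _ _ (is_derive_sinf s).
move=> /(_ _ (norm_sinf s)) H; apply/eqP; rewrite -subr_eq0 mulNr opprK.
rewrite -RintegralZl//; last first.
  exact: (integrable_horner_gaussM _ _ (@continuous_cosf _ s) (norm_cosf s)).
apply/eqP; rewrite -[RHS]H.
- by congr (_ + _); apply: eq_Rintegral => t _; ring.
- by move=> t; apply: cvgM; [exact: cvg_cst|exact: continuous_cosf].
- by move=> t; rewrite normrM ler_piMr// norm_cosf.
Qed.

(** Differentiation under the integral sign: the derivative in [r] of [T r t] is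
[t * U r t], and the factor [t] is absorbed by the polynomial, which also gives
a dominating function independent of [r]. *)
Lemma is_derive_gaussI (R : realType) (c s : R) (P : {poly R}) (T U : R -> R -> R) :
  (forall r, continuous (T r)) -> (forall r t, `|T r t| <= 1) ->
  (forall r t, `|U r t| <= 1) ->
  (forall t r : R, is_derive r (1 : R) (T^~ t) (t * U r t)) ->
  is_derive s (1 : R) (fun r => gaussI c (T r) P) (gaussI c (U s) (P * 'X)).
Proof.
move=> cT TM UM dT.
pose f r t := P.[t] * gauss c t * T r t.
pose G t := `|(P * 'X).[t] * gauss c t|.
have df r t : is_derive r (1 : R) (f^~ t) (P.[t] * gauss c t * (t * U r t)).
  by have := dT t r => d; apply: is_derive_eq; rewrite /GRing.scale /=; ring.
have pE r t : partial1of2 f r t = P.[t] * gauss c t * (t * U r t).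
  by rewrite partial1of2E derive_val.
have intf r : `]s - 1, s + 1[%classic r ->
    lebesgue_measure.-integrable [set: R] (EFin \o f r).
  by move=> _; exact: (integrable_horner_gaussM _ _ (cT r) (TM r)).
have G0 t : 0 <= G t by exact: normr_ge0.
have intG : lebesgue_measure.-integrable [set: R] (EFin \o G).
  have := integrable_horner_gaussM c (P * 'X) (@cst_continuous R R (1 : R))
    (fun _ => ltac:(rewrite normr1; exact: lexx) : `|1 : R| <= 1).
  move=> /integrable_norm; apply: eq_integrable => // t _ /=.
  by rewrite mulr1.
have Gub r t : `]s - 1, s + 1[%classic r -> [set: R]%classic t ->
    `|partial1of2 f r t| <= G t.
  move=> _ _; rewrite pE /G hornerMX.
  rewrite (_ : _ * (t * _) = P.[t] * t * gauss c t * U r t); last by ring.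
  by rewrite normrM ler_piMr.
have sI : `]s - 1, s + 1[%classic s by rewrite /= in_itv /=; apply/andP; split; lra.
have dI r t : `]s - 1, s + 1[%classic r -> [set: R]%classic t -> derivable (f^~ t) r 1.
  by move=> _ _; exact: ex_derive.
have D := derivable_under_integral measurableT sI intf dI G0 intG Gub.
have E := differentiation_under_integral measurableT sI intf dI G0 intG Gub.
apply: DeriveDef; first exact: D.
rewrite -derive1E E.
apply: eq_Rintegral => t _; by rewrite pE hornerMX; ring.
Qed.

(** The case [P = 1] of integration by parts: the first moment is a combination
of the transforms themselves. *)
Lemma gaussI_cosX (R : realType) (c s : R) :
  gaussI c (cosf s) 'X =
  c * gaussI c (cosf s) 1 - s / 2 * gaussI c (sinf s) 1.
Proof.
have := gaussI_cos_parts c s 1.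
rewrite (_ : _ - _ = (- 2)%:P * 'X + (2 * c)%:P * 1); last first.
  by rewrite derivC polyCN polyCM; ring.
rewrite (gaussID _ (@continuous_cosf _ s) (norm_cosf s)).
rewrite !(gaussIM _ (@continuous_cosf _ s) (norm_cosf s)); lra.
Qed.

Lemma gaussI_sinX (R : realType) (c s : R) :
  gaussI c (sinf s) 'X =
  c * gaussI c (sinf s) 1 + s / 2 * gaussI c (cosf s) 1.
Proof.
have := gaussI_sin_parts c s 1.
rewrite (_ : _ - _ = (- 2)%:P * 'X + (2 * c)%:P * 1); last first.
  by rewrite derivC polyCN polyCM; ring.
rewrite (gaussID _ (@continuous_sinf _ s) (norm_sinf s)).
rewrite !(gaussIM _ (@continuous_sinf _ s) (norm_sinf s)); lra.
Qed.

Lemma is_derive_gaussI_cos (R : realType) (c s : R) :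
  is_derive s (1 : R) (fun r => gaussI c (cosf r) 1) (- gaussI c (sinf s) 'X).
Proof.
have -> : - gaussI c (sinf s) 'X = gaussI c (fun t => - sinf s t) (1 * 'X).
  rewrite /gaussI -mulN1r -RintegralZl//.
    by apply: eq_Rintegral => t _; rewrite mul1r; ring.
  exact: (integrable_horner_gaussM _ _ (@continuous_sinf _ s) (norm_sinf s)).
apply: (@is_derive_gaussI _ c s 1 (@cosf R) (fun r t => - sinf r t)).
- by move=> r; exact: continuous_cosf.
- exact: norm_cosf.
- by move=> r t; rewrite normrN norm_sinf.
- move=> t r; rewrite (_ : (@cosf R)^~ t = cosf t); last first.
    by apply/funext => y; rewrite /cosf mulrC.
  rewrite (_ : _ * _ = - t * sinf t r); first exact: is_derive_cosf.
  by rewrite /sinf (mulrC r) mulrN mulNr.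
Qed.

Lemma is_derive_gaussI_sin (R : realType) (c s : R) :
  is_derive s (1 : R) (fun r => gaussI c (sinf r) 1) (gaussI c (cosf s) 'X).
Proof.
rewrite -['X]mul1r.
apply: (@is_derive_gaussI _ c s 1 (@sinf R) (@cosf R)).
- by move=> r; exact: continuous_sinf.
- exact: norm_sinf.
- exact: norm_cosf.
- move=> t r; rewrite (_ : (@sinf R)^~ t = sinf t); last first.
    by apply/funext => y; rewrite /sinf mulrC.
  by have -> : cosf r t = cosf t r; [rewrite /cosf mulrC|exact: is_derive_sinf].
Qed.

(** The real and imaginary parts [A], [B] of the transform solve
[A' = - c B - (s/2) A] and [B' = c A - (s/2) B].  Multiplying [A + iB] by
[e^{s^2/4} e^{-ics}] gives [U + iV] with zero derivative, hence the constant
[A 0 + i B 0 = sqrt pi]. *)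
Lemma gaussI_1 (R : realType) (c s : R) :
  gaussI c (cosf s) 1 = Num.sqrt pi * expR (- (s ^+ 2 / 4)) * cos (c * s) /\
  gaussI c (sinf s) 1 = Num.sqrt pi * expR (- (s ^+ 2 / 4)) * sin (c * s).
Proof.
pose A (r : R) : R := gaussI c (cosf r) 1.
pose B (r : R) : R := gaussI c (sinf r) 1.
pose E (r : R) : R := expR (r ^+ 2 / 4).
have dA r : is_derive r (1 : R) A (- (c * B r + r / 2 * A r)).
  by rewrite -gaussI_sinX; exact: is_derive_gaussI_cos.
have dB r : is_derive r (1 : R) B (c * A r - r / 2 * B r).
  by rewrite -gaussI_cosX; exact: is_derive_gaussI_sin.
have dE r : is_derive r (1 : R) E (r / 2 * E r).
  apply: (is_derive_eq (f' := expR (r ^+ 2 / 4) * (r / 2))); last by rewrite /E; ring.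
  apply: (is_derive1_comp (f := expR) (g := fun r => r ^+ 2 / 4)).
  by apply: is_derive_eq; rewrite /GRing.scale /=; field.
have dC r : is_derive r (1 : R) (cosf c) (- c * sinf c r) := is_derive_cosf c r.
have dS r : is_derive r (1 : R) (sinf c) (c * cosf c r) := is_derive_sinf c r.
pose U r := E r * (A r * cosf c r + B r * sinf c r).
pose V r := E r * (B r * cosf c r - A r * sinf c r).
have dU (r : R) : is_derive r (1 : R) U 0.
  by apply: is_derive_eq; rewrite /GRing.scale /=; field.
have dV (r : R) : is_derive r (1 : R) V 0.
  by apply: is_derive_eq; rewrite /GRing.scale /=; field.
have A0 : A 0 = Num.sqrt pi.
  rewrite /A /gaussI -(Rintegral_gauss c); apply: eq_Rintegral => t _.
  by rewrite hornerC mul1r /cosf mul0r cos0 mulr1.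
have B0 : B 0 = 0.
  rewrite /B /gaussI /Rintegral integral0_eq// => t _.
  by rewrite /sinf mul0r sin0 mulr0.
have HU := is_derive_0_is_cst s 0 dU.
have HV := is_derive_0_is_cst s 0 dV.
move: HU HV; rewrite /U /V A0 B0 /E expr0n /= mul0r expR0 /cosf /sinf !mulr0 cos0 sin0.
have := cos2Dsin2 (c * s).
have Ep : expR (- (s ^+ 2 / 4)) * expR (s ^+ 2 / 4) = 1 by rewrite mulrC expRxMexpNx_1.
rewrite -/(A s) -/(B s); set C := cos _; set S := sin _; set e := expR (- _) in Ep *.
set E' := expR _ in Ep * => CS HU HV.
(* Undo the rotation by the angle [c * s] using [C ^+ 2 + S ^+ 2 = 1]. *)
have HU' : A s * C + B s * S = Num.sqrt pi * e.
  by rewrite -[LHS]mul1r -Ep -mulrA HU; ring.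
have HV' : B s * C - A s * S = 0.
  by rewrite -[LHS]mul1r -Ep -mulrA HV; ring.
split.
  by rewrite -HU' -[LHS]mulr1 -CS; move/eqP: HV'; rewrite subr_eq0 => /eqP HV'; ring: HV'.
by rewrite -HU' -[LHS]mulr1 -CS; move/eqP: HV'; rewrite subr_eq0 => /eqP HV'; ring: HV'.
Qed.

(** * The Fourier transform of a Gaussian times a polynomial *)

Lemma cexp_imag (R : realType) (y : R) : cexp ('i%C * y%:C) = cos y +i* sin y.
Proof.
rewrite /cexp /= !mul0r mul1r subr0 !add0r.
by rewrite expR0 !mul1r.
Qed.

Lemma cexp_real (R : realType) (y : R) : cexp y%:C = (expR y)%:C.
Proof. by rewrite /cexp /= cos0 sin0 mulr1 mulr0. Qed.

Lemma cexpD (R : realType) (z w : R[i]) : cexp (z + w) = cexp z * cexp w.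
Proof.
case: z => a b; case: w => c d; rewrite /cexp /= expRD cosD sinD.
by apply/eqP; rewrite eq_complex /=; apply/andP; split; apply/eqP; ring.
Qed.

(** This is the integral of [P(t) e^{-(t-c)^2} e^{ist}], split into its real and
imaginary parts. *)
Definition gaussF (R : realType) (c s : R) (P : {poly R}) : R[i] :=
  gaussI c (cosf s) P +i* gaussI c (sinf s) P.

Lemma gaussFD (R : realType) (c s : R) (P Q : {poly R}) :
  gaussF c s (P + Q) = gaussF c s P + gaussF c s Q.
Proof.
rewrite /gaussF (gaussID _ (@continuous_cosf _ s) (norm_cosf s)).
by rewrite (gaussID _ (@continuous_sinf _ s) (norm_sinf s)).
Qed.

Lemma gaussFM (R : realType) (c s a : R) (P : {poly R}) :
  gaussF c s (a%:P * P) = a%:C * gaussF c s P.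
Proof.
rewrite /gaussF (gaussIM _ (@continuous_cosf _ s) (norm_cosf s)).
rewrite (gaussIM _ (@continuous_sinf _ s) (norm_sinf s)).
by apply/eqP; rewrite eq_complex /=; apply/andP; split; apply/eqP; ring.
Qed.

Lemma gaussF_parts (R : realType) (c s : R) (P : {poly R}) :
  gaussF c s (P^`() - 2%:P * ('X - c%:P) * P) = - ('i%C * s%:C * gaussF c s P).
Proof.
rewrite /gaussF gaussI_cos_parts gaussI_sin_parts.
by apply/eqP; rewrite eq_complex /=; apply/andP; split; apply/eqP; ring.
Qed.

Lemma gaussF_1 (R : realType) (c s : R) :
  gaussF c s 1 =
  (Num.sqrt pi)%:C * cexp (- (s ^+ 2 / 4)%:C + 'i%C * (c * s)%:C).
Proof.
rewrite cexpD -rmorphN cexp_real cexp_imag /gaussF (gaussI_1 c s).1 (gaussI_1 c s).2.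
by apply/eqP; rewrite eq_complex /=; apply/andP; split; apply/eqP; ring.
Qed.

(** * Hermite polynomials *)

(** The recursion is the one that differentiating [He_m(t) e^{-t^2}] produces, up
to sign, so that Rodrigues' formula follows by induction. *)
Fixpoint hermite (R : realType) (m : nat) : {poly R} :=
  if m is m'.+1 then 2%:P * 'X * hermite R m' - (hermite R m')^`() else 1.

Lemma derivn_gauss (R : realType) (m : nat) :
  derive1n m (fun t : R => expR (- t ^+ 2)) =
  (fun t => (-1) ^+ m * (hermite R m).[t] * expR (- t ^+ 2)).
Proof.
elim: m => [|m IH].
  by apply/funext => t; rewrite derive1n0 /= hornerC expr0 !mul1r.
apply/funext => t; rewrite derive1nS IH derive1E.
have dg : is_derive t (1 : R) (fun t : R => expR (- t ^+ 2)) (- (2 * t * expR (- t ^+ 2))).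
  have := is_derive_gauss 0 t; rewrite /gauss subr0.
  by under eq_fun do rewrite subr0.
have dP : is_derive t (1 : R) (fun t => (-1) ^+ m * (hermite R m).[t] * expR (- t ^+ 2))
    ((-1) ^+ m.+1 * (hermite R m.+1).[t] * expR (- t ^+ 2)).
  have scE (a b : R) : a *: (b : R^o) = a * b by [].
  by apply: is_derive_eq; rewrite !scE !hornerE (exprS (-1)) /=; ring.
by rewrite derive_val.
Qed.

Lemma hermite_funE (R : realType) (m : nat) (t : R) :
  hermite_fun m t = (hermite R m).[t] * expR (- (t ^+ 2 / 2)).
Proof.
rewrite /hermite_fun derivn_gauss /=.
transitivity ((-1) ^+ m * (-1) ^+ m * (hermite R m).[t] *
   (expR (t ^+ 2 / 2) * expR (- t ^+ 2))); first by ring.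
rewrite -exprMn mulrNN mulr1 expr1n mul1r -expRD; congr (_ * expR _).
by field.
Qed.

Lemma deriv_hermite (R : realType) (m : nat) :
  (hermite R m.+1)^`() = (2 * m.+1%:R)%:P * hermite R m.
Proof.
elim: m => [|m IH].
  by rewrite /= derivC subr0 !mulr1 derivM derivC mul0r add0r derivX mulr1.
rewrite [hermite R m.+2]/(2%:P * 'X * hermite R m.+1 - (hermite R m.+1)^`()).
rewrite derivB [in X in _ - X]IH !derivM !derivC derivX IH /=.
rewrite -(natr1 m.+1) !polyCM polyCD; ring.
Qed.

(** * Recurrence for the transform of a product of two Hermite polynomials *)

Definition hermite2 (R : realType) (u x : R) (k m : nat) : {poly R} :=
  (hermite R k \Po ('X - u%:P)) * (hermite R m \Po ('X - x%:P)).

Lemma hermite_compS (R : realType) (u : R) (k : nat) :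
  hermite R k.+1 \Po ('X - u%:P) = 2%:P * ('X - u%:P) * (hermite R k \Po ('X - u%:P))
    - ((hermite R k)^`() \Po ('X - u%:P)).
Proof. by rewrite /= comp_polyB !comp_polyM comp_polyC comp_polyX. Qed.

Lemma deriv_hermite_comp (R : realType) (u : R) (k : nat) :
  (hermite R k \Po ('X - u%:P))^`() = (hermite R k)^`() \Po ('X - u%:P).
Proof. by rewrite deriv_comp derivB derivX derivC subr0 mulr1. Qed.

(** Since [He_{k+1}(t-u) = 2(t-u) He_k(t-u) - He_k'(t-u)] and
[2(t-u) = 2(t-c) + (x-u)], the polynomial of index [k+1] is
[- (P' - 2(t-c) P) + (x-u) P + He_k(t-u) He_m'(t-x)] for the polynomial [P] of
index [k]; integration by parts evaluates the first bracket. *)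
Lemma gaussF_recl (R : realType) (u x s : R) (k m : nat) (c := (u + x) / 2) :
  gaussF c s (hermite2 u x k.+1 m) =
  ((x - u)%:C + 'i%C * s%:C) * gaussF c s (hermite2 u x k m)
  + gaussF c s ((hermite R k \Po ('X - u%:P)) * ((hermite R m)^`() \Po ('X - x%:P))).
Proof.
have Hp := gaussF_parts c s (hermite2 u x k m).
have -> : hermite2 u x k.+1 m = (-1)%:P * ((hermite2 u x k m)^`() -
   2%:P * ('X - c%:P) * hermite2 u x k m) + (x - u)%:P * hermite2 u x k m
   + (hermite R k \Po ('X - u%:P)) * ((hermite R m)^`() \Po ('X - x%:P)).
  rewrite /hermite2 derivM !deriv_hermite_comp hermite_compS.
  have -> : 2%:P * ('X - c%:P) = 2%:P * 'X - u%:P - x%:P :> {poly R}.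
    by rewrite mulrBr -polyCM -addrA -opprD -polyCD; congr (_ - _%:P); rewrite /c; field.
  rewrite polyCN polyCB; ring.
by rewrite 2!gaussFD 2!gaussFM Hp rmorphN rmorph1; ring.
Qed.

(** Exchanging the two factors exchanges the centres [u] and [x]; this turns the
recurrence in [k] into the one in [m]. *)
Lemma hermite2C (R : realType) (u x : R) (k m : nat) :
  hermite2 u x k m = hermite2 x u m k.
Proof. by rewrite /hermite2 mulrC. Qed.

Lemma gaussF_rec0 (R : realType) (u x s : R) (k : nat) (c := (u + x) / 2) :
  gaussF c s (hermite2 u x k.+1 0) =
  ((x - u)%:C + 'i%C * s%:C) * gaussF c s (hermite2 u x k 0).
Proof.
rewrite gaussF_recl /= derivC comp_poly0 mulr0 -/c.
have -> : gaussF c s 0 = 0 by rewrite -(mulr0 0%:P) gaussFM mul0r.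
by rewrite addr0.
Qed.

Lemma gaussF_recS (R : realType) (u x s : R) (k m : nat) (c := (u + x) / 2) :
  gaussF c s (hermite2 u x k.+1 m.+1) =
  ((x - u)%:C + 'i%C * s%:C) * gaussF c s (hermite2 u x k m.+1)
  + 2 * m.+1%:R * gaussF c s (hermite2 u x k m).
Proof.
rewrite gaussF_recl deriv_hermite comp_polyM comp_polyC mulrCA gaussFM -/c.
by rewrite rmorphM /= !rmorph_nat.
Qed.

(** * Recurrences for the complex Hermite polynomials *)

Section Chermite2.
Variables (R : realType) (z w : R[i]).
Implicit Types k l j : nat.

Let term k l j : R[i] :=
  (-1) ^+ j * (j`!)%:R * ('C(k, j))%:R * ('C(l, j))%:R
      * z ^+ (l - j) * w ^+ (k - j).

(** The binomial coefficients vanish beyond [minn k l], so the summation range may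
be chosen common to several indices. *)
Lemma chermite2_widen N k l : (minn k l < N)%N ->
  chermite2 k l z w = \sum_(0 <= j < N) term k l j.
Proof.
move=> hN; rewrite (big_cat_nat (n := (minn k l).+1))//=.
rewrite [X in _ + X]big_nat [X in _ + X]big1 ?addr0// => j /andP[h _].
rewrite /term; move: h; rewrite gtn_min => /orP[h|h];
  rewrite (bin_small h) ?mulr0 ?mul0r//.
Qed.

Lemma chermite20l l : chermite2 0 l z w = z ^+ l.
Proof.
rewrite /chermite2 min0n big_nat1 !bin0 !subn0 fact0 !expr0; ring.
Qed.

Lemma chermite2S0 k : chermite2 k.+1 0 z w = w * chermite2 k 0 z w.
Proof.
rewrite /chermite2 !minn0 !big_nat1 !bin0 !subn0 exprS; ring.
Qed.

(** Pascal's rule on ['C(k.+1, j.+1)] splits the sum: the part with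
['C(k, j.+1)] is [w] times the sum for [(k, l+1)], and the part with ['C(k, j)]
is [- (l+1)] times the sum for [(k, l)], because
[(j+1) 'C(l+1, j+1) = (l+1) 'C(l, j)]. *)
Lemma chermite2SS k l :
  chermite2 k.+1 l.+1 z w = w * chermite2 k l.+1 z w - l.+1%:R * chermite2 k l z w.
Proof.
rewrite (@chermite2_widen k.+2) ?ltnS ?geq_minl//.
rewrite (@chermite2_widen k.+2 k) ?ltnS ?(leq_trans (geq_minl _ _))//.
rewrite (@chermite2_widen k.+1) ?ltnS ?geq_minl//.
rewrite big_nat_recl// [in X in _ = w * X - _]big_nat_recl// mulrDr -addrA; congr (_ + _).
  by rewrite /term !bin0 !subn0 (exprS w); ring.
rewrite !mulr_sumr -sumrB; apply: eq_big_nat => j /andP[_ jk].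
have e1 : l.+1%:R * 'C(l, j)%:R = j.+1%:R * 'C(l.+1, j.+1)%:R :> R[i].
  by rewrite -!natrM mul_bin_diag.
rewrite /term subSS subSS binS natrD factS natrM exprS.
(* For [j >= k] the truncated exponents differ, but the binomial is zero. *)
have -> : w * ((-1) * (-1) ^+ j * (j.+1%:R * j`!%:R) * 'C(k, j.+1)%:R * 'C(l.+1, j.+1)%:R
     * z ^+ (l - j) * w ^+ (k - j.+1)) =
   (-1) * (-1) ^+ j * (j.+1%:R * j`!%:R) * 'C(k, j.+1)%:R * 'C(l.+1, j.+1)%:R
     * z ^+ (l - j) * w ^+ (k - j).
  have [kj|kj] := ltnP j k.
    by rewrite -[in RHS](subnSK kj) exprS; ring.
  by rewrite (@bin_small k j.+1)//; ring.
have -> : l.+1%:R * ((-1) ^+ j * j`!%:R * 'C(k, j)%:R * 'C(l, j)%:R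
     * z ^+ (l - j) * w ^+ (k - j)) =
   (-1) ^+ j * j`!%:R * 'C(k, j)%:R * (l.+1%:R * 'C(l, j)%:R)
     * z ^+ (l - j) * w ^+ (k - j) by ring.
by rewrite e1; ring.
Qed.
End Chermite2.

(** Both sides satisfy the same recurrence, because [sqrt 2 z = (u-x) + is] and
[sqrt 2 z^* = - ((x-u) + is)].  The row [k = 0] needs its own induction on [m],
where the roles of [u] and [x] are exchanged. *)
Lemma gaussF_hermite2 (R : realType) (u x s : R) (k m : nat)
    (c := (u + x) / 2) (z := ((u - x)%:C + 'i%C * s%:C) / (Num.sqrt 2)%:C) :
  gaussF c s (hermite2 u x k m) =
  gaussF c s 1 * (-1) ^+ k * (Num.sqrt 2)%:C ^+ (k + m) * chermite2 k m z (z^*)%C.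
Proof.
have r0 : (Num.sqrt 2)%:C != 0 :> R[i].
  by rewrite fmorph_eq0 gt_eqF// sqrtr_gt0.
have r2 : (Num.sqrt 2)%:C * (Num.sqrt 2)%:C = 2 :> R[i].
  by rewrite -rmorphM /= -expr2 sqr_sqrtr// rmorph_nat.
have rz : (Num.sqrt 2)%:C * z = (u - x)%:C + 'i%C * s%:C.
  by rewrite /z mulrCA divff// mulr1.
have rzC : (Num.sqrt 2)%:C * (z^*)%C = - ((x - u)%:C + 'i%C * s%:C).
  have conjM (p q : R[i]) : ((p * q)^*)%C = (p^*)%C * (q^*)%C by exact: rmorphM.
  have -> : (Num.sqrt 2)%:C * (z^*)%C = (((Num.sqrt 2)%:C * z)^*)%C.
    by rewrite [RHS]conjM conjc_real.
  rewrite rz.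
  by apply/eqP; rewrite eq_complex /=; apply/andP; split; apply/eqP; ring.
elim: k m => [|k IH] m.
  rewrite chermite20l expr0 mulr1 add0n -mulrA -exprMn rz.
  elim: m => [|m IH].
    by rewrite /hermite2 /= !comp_polyC mulr1 expr0 mulr1.
  rewrite hermite2C /c [u + x]addrC gaussF_rec0 hermite2C [x + u]addrC -/c IH exprS.
  by ring.
case: m => [|m].
  rewrite gaussF_rec0 -/c IH chermite2S0 !addn0 -[(x - u)%:C + _]opprK -rzC !exprS; ring.
rewrite gaussF_recS -/c !IH chermite2SS -[(x - u)%:C + _]opprK -rzC.
rewrite addSn addnS exprS [_ ^+ (k + m).+2]exprS [_ ^+ (k + m).+1]exprS -r2.
by rewrite [_ ^+ k.+1]exprS; ring.
Qed.

(** * Finite sums and the short-time Fourier transform *)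

Lemma Rintegral_gauss_sum (R : realType) (c : R) (P : {poly R}) (b : nat -> R)
    (T : nat -> R -> R) (N : nat) :
  (forall j, continuous (T j)) -> (forall j t, `|T j t| <= 1) ->
  Rintegral lebesgue_measure setT
    (fun t => \sum_(0 <= j < N) b j * (P.[t] * gauss c t * T j t)) =
  \sum_(0 <= j < N) b j * gaussI c (T j) P.
Proof.
move=> cT TM.
have iT j : lebesgue_measure.-integrable [set: R]
    (EFin \o (fun t => b j * (P.[t] * gauss c t * T j t))).
  have := integrableZl measurableT (b j) (integrable_horner_gaussM c P (cT j) (TM j)).
  by apply: eq_integrable.
have iS n : lebesgue_measure.-integrable [set: R]
    (EFin \o (fun t => \sum_(0 <= j < n) b j * (P.[t] * gauss c t * T j t))).
  have := integrable_sum measurableT (index_iota 0 n) (fun j _ => iT j) (P := xpredT).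
  by apply: eq_integrable => // t _ /=; rewrite sumEFin.
elim: N => [|N IH].
  rewrite big_geq// /Rintegral integral0_eq// => t _.
  by rewrite big_geq.
rewrite big_nat_recr//= -IH.
rewrite -RintegralZl//; last exact: (integrable_horner_gaussM _ _ (cT N) (TM N)).
rewrite -RintegralD//; apply: eq_Rintegral => t _.
by rewrite big_nat_recr.
Qed.

Lemma cintegral_gauss_sum (R : realType) (c : R) (P : {poly R}) (b s : nat -> R) (N : nat) :
  cintegral (fun t => \sum_(0 <= j < N)
     (b j)%:C * ((P.[t] * gauss c t)%:C * cexp ('i%C * (s j * t)%:C))) =
  \sum_(0 <= j < N) (b j)%:C * gaussF c (s j) P.
Proof.
have ReS (F : nat -> R[i]) n :
    complex.Re (\sum_(0 <= j < n) F j) = \sum_(0 <= j < n) complex.Re (F j).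
  exact: (raddf_sum (@complex.Re R : Rcomplex R -> R)).
have ImS (F : nat -> R[i]) n :
    complex.Im (\sum_(0 <= j < n) F j) = \sum_(0 <= j < n) complex.Im (F j).
  exact: (raddf_sum (@complex.Im R : Rcomplex R -> R)).
apply/eqP; rewrite eq_complex ReS ImS /=; apply/andP; split; apply/eqP.
- transitivity (\sum_(0 <= j < N) b j * gaussI c (cosf (s j)) P); last first.
    by apply: eq_bigr => j _; rewrite mul0r subr0.
  rewrite -Rintegral_gauss_sum; first last.
  + by move=> j t; exact: norm_cosf.
  + by move=> j; exact: continuous_cosf.
  apply: eq_Rintegral => t _; rewrite ReS; apply: eq_bigr => j _.
  by rewrite cexp_imag /cosf /=; ring.
- transitivity (\sum_(0 <= j < N) b j * gaussI c (sinf (s j)) P); last first.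
    by apply: eq_bigr => j _; rewrite mul0r addr0.
  rewrite -Rintegral_gauss_sum; first last.
  + by move=> j t; exact: norm_sinf.
  + by move=> j; exact: continuous_sinf.
  apply: eq_Rintegral => t _; rewrite ImS; apply: eq_bigr => j _.
  by rewrite cexp_imag /sinf /=; ring.
Qed.

Theorem theorem5p17 (R : realType) (n k m : nat) (a x u eta : R)
    (hn : (0 < n)%N) (ha : 1 < a) :
  STFT (fun t => (hermite_fun k t)%:C) (fun t => so_signal n m x a t) u eta =
  (Num.sqrt pi)%:C * (-1) ^+ k * (2 `^ ((k + m)%:R / 2))%:C
    * cexp (- ('i%C * ((x + u) * eta / 2)%:C) - ((x - u) ^+ 2 / 4)%:C)
    * \sum_(0 <= j < n.+1)
        (so_coef j n a)%:C
        * cexp (- ((so_freq R n j - eta) ^+ 2 / 4)%:C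
                + 'i%C * ((u + x) * so_freq R n j / 2)%:C)
        * chermite2 k m (so_alpha n j x u eta) ((so_alpha n j x u eta)^*)%C.
Proof.
pose c := (u + x) / 2.
pose e0 := expR (- ((x - u) ^+ 2 / 4)).
have -> : STFT (fun t => (hermite_fun k t)%:C) (fun t => so_signal n m x a t) u eta =
    \sum_(0 <= j < n.+1) (so_coef j n a * e0)%:C *
      gaussF c (so_freq R n j - eta) (hermite2 u x k m).
  rewrite -cintegral_gauss_sum /STFT; congr cintegral; apply/funext => t.
  rewrite /so_signal /so_seq conjc_real mulrA mulr_sumr; apply: eq_bigr => j _.
  have -> : 'i%C * ((so_freq R n j - eta) * t)%:C =
      - ('i%C * (t * eta)%:C) + 'i%C * (so_freq R n j * t)%:C.
    rewrite (_ : (_ - _) * t = - (t * eta) + so_freq R n j * t); last by ring.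
    by rewrite rmorphD rmorphN /= mulrDr mulrN.
  (* Completing the square around the midpoint [c]. *)
  have gE : expR (- ((t - u) ^+ 2 / 2)) * expR (- ((t - x) ^+ 2 / 2)) = e0 * gauss c t.
    by rewrite -!expRD; congr expR; rewrite /c; field.
  rewrite cexpD !hermite_funE /hermite2 hornerM !horner_comp !hornerXsubC.
  have alg (p q d e1 e2 g : R) (w1 w2 : R[i]) : e1 * e2 = e0 * g ->
      w1 * (p * e1)%:C * (q * e2)%:C * (d%:C * w2) =
      (d * e0)%:C * ((p * q * g)%:C * (w1 * w2)).
    move=> eg; transitivity ((d * p * q * (e1 * e2))%:C * (w1 * w2)).
      by rewrite !rmorphM; ring.
    by rewrite eg !rmorphM; ring.
  exact: alg.
have -> : 2 `^ ((k + m)%:R / 2) = Num.sqrt 2 ^+ (k + m) :> R.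
  by rewrite mulrC powRrM powR12_sqrt// powR_mulrn.
rewrite mulr_sumr; apply: eq_bigr => j _.
rewrite gaussF_hermite2 gaussF_1 -/c -/(so_alpha n j x u eta).
set H := chermite2 _ _ _ _.
rewrite rmorphXn /=.
set s := so_freq R n j - eta.
(* With [c = (u + x) / 2], the phase [e^{ics}] splits into a factor depending on
   [eta] alone and one depending on [omega_j] alone. *)
have cE : e0%:C * cexp (- (s ^+ 2 / 4)%:C + 'i%C * (c * s)%:C) =
    cexp (- ('i%C * ((x + u) * eta / 2)%:C) - ((x - u) ^+ 2 / 4)%:C)
    * cexp (- (s ^+ 2 / 4)%:C + 'i%C * ((u + x) * so_freq R n j / 2)%:C).
  rewrite -cexp_real -!cexpD; congr cexp.
  have -> : c * s = (u + x) * so_freq R n j / 2 - (x + u) * eta / 2.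
    by rewrite /c /s; field.
  by rewrite rmorphB rmorphN; ring.
rewrite rmorphM /=.
transitivity ((so_coef j n a)%:C * (Num.sqrt pi)%:C * (-1) ^+ k
   * (Num.sqrt 2)%:C ^+ (k + m)
   * (e0%:C * cexp (- (s ^+ 2 / 4)%:C + 'i%C * (c * s)%:C))
   * H); first by ring.
by rewrite cE; ring.
Qed.
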